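(* There exist finitely presented intersection-saturated groups.
   Context: For $k\ge 1$, $[k]=\{1,\ldots,k\}$ and $\mathcal{P}([k])$ is its power set. A $k$-configuration is a map $\chi\colon\mathcal{P}([k])\setminus\{\varnothing\}\to\{0,1\}$; a finite configuration is a $k$-configuration for some $k\ge 1$. Subgroups $H_1,\ldots,H_k$ (possibly with repetitions) of a group $G$ realize $\chi$ if, for every nonempty $I\subseteq[k]$, the intersection $\bigcap_{i\in I}H_i$ is finitely generated when $\chi(I)=0$ and not finitely generated when $\chi(I)=1$. The configuration $\chi$ is realizable in $G$ if some $k$ subgroups of $G$ realize it. A group $G$ is intersection-saturated if every finite configuration is realizable in $G$. *)

(* Defs.v *)
From HB Require Import structures.
From mathcomp Require Import all_boot.
From mathcomp Require Import boolp classical_sets.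

Set Implicit Arguments.
Unset Strict Implicit.
Unset Printing Implicit Defensive.

Local Open Scope group_scope.
Local Open Scope classical_set_scope.

Section FreeGroup.
Variable X : choiceType.

(* (x, true) stands for x and (x, false) for its formal inverse. *)
Definition letter := (X * bool)%type.

Definition linv (a : letter) : letter := (a.1, ~~ a.2).

Definition reduced (w : seq letter) : bool :=
  sorted (fun a b => b != linv a) w.

Definition push (a : letter) (w : seq letter) : seq letter :=
  if w is b :: w' then if b == linv a then w' else a :: w else [:: a].

Definition reduce (w : seq letter) : seq letter := foldr push [::] w.

Definition winv (w : seq letter) : seq letter := rev (map linv w).

Lemma linvK : involutive linv.
Proof. by case=> x b; rewrite /linv /= negbK. Qed.

Lemma push_reduced a w : reduced w -> reduced (push a w).
Proof.
case: w => [|b w] //= rw; case: eqP => [_|/eqP ne] /=.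
  exact: path_sorted rw.
by rewrite ne.
Qed.

Lemma foldr_push_reduced w s : reduced s -> reduced (foldr push s w).
Proof. by move=> rs; elim: w => //= a w IH; apply: push_reduced. Qed.

Lemma reduce_reduced w : reduced (reduce w).
Proof. exact: foldr_push_reduced. Qed.

Lemma pushK a w : reduced w -> push (linv a) (push a w) = w.
Proof.
case: w => [|b w] /=; first by rewrite linvK eqxx.
case: (eqVneq b (linv a)) => [->|ne] /=; last by rewrite linvK eqxx.
by case: w => [|c w] //= /andP[/negPf ->].
Qed.

Lemma pushVK a w : reduced w -> push a (push (linv a) w) = w.
Proof. by move=> rw; rewrite -{1}[a]linvK pushK. Qed.

Lemma reduce_id w : reduced w -> reduce w = w.
Proof.
elim: w => //= a w IH p; have rw : reduced w := path_sorted p.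
by rewrite IH //; case: w p {IH rw} => [|b w] //= /andP[/negPf ->].
Qed.

Lemma foldr_push_reduce w s : reduced s ->
  foldr push s (reduce w) = foldr push s w.
Proof.
move=> rs; elim: w => //= a w <-.
case: (reduce w) => [|b v] //=.
case: eqP => [->|] //=; rewrite pushVK //.
exact: foldr_push_reduced.
Qed.

Lemma reduce_cat u v : reduce (u ++ v) = foldr push (reduce v) u.
Proof. exact: foldr_cat. Qed.

Lemma reduce_catl u v : reduce (reduce u ++ v) = reduce (u ++ v).
Proof. by rewrite !reduce_cat foldr_push_reduce // reduce_reduced. Qed.

Lemma reduce_catr u v : reduce (u ++ reduce v) = reduce (u ++ v).
Proof. by rewrite !reduce_cat (reduce_id (reduce_reduced v)). Qed.

Lemma reduce_winvl w : reduce (winv w ++ w) = [::].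
Proof.
elim: w => //= a w IH.
rewrite /winv /= rev_cons -cats1 -catA /= reduce_cat /=.
by rewrite pushK ?reduce_reduced // -reduce_cat.
Qed.

Lemma winvK : involutive winv.
Proof. by move=> w; rewrite /winv map_rev revK mapK //; exact: linvK. Qed.

Lemma reduce_winvr w : reduce (w ++ winv w) = [::].
Proof. by rewrite -{1}[w]winvK reduce_winvl. Qed.

Record freeGroup := FreeGroup { fgword :> seq letter; _ : reduced fgword }.

HB.instance Definition _ := [isSub for fgword].
HB.instance Definition _ := [Choice of freeGroup by <:].

Definition fgred (w : seq letter) : freeGroup := FreeGroup (reduce_reduced w).

Definition fgone : freeGroup := fgred [::].
Definition fgmul (u v : freeGroup) : freeGroup := fgred (u ++ v).
Definition fginv (u : freeGroup) : freeGroup := fgred (winv u).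

Lemma fgmulA : associative fgmul.
Proof.
by move=> u v w; apply: val_inj; rewrite /= reduce_catr reduce_catl catA.
Qed.

Lemma fgmul1 : right_id fgone fgmul.
Proof. by case=> u ru; apply: val_inj; rewrite /= cats0 reduce_id. Qed.

Lemma fg1mul : left_id fgone fgmul.
Proof. by case=> u ru; apply: val_inj; rewrite /= reduce_id. Qed.

Lemma fgmulV : right_inverse fgone fginv fgmul.
Proof. by move=> u; apply: val_inj; rewrite /= reduce_catr reduce_winvr. Qed.

Lemma fgVmul : left_inverse fgone fginv fgmul.
Proof. by move=> u; apply: val_inj; rewrite /= reduce_catl reduce_winvl. Qed.

HB.instance Definition _ :=
  isGroup.Build freeGroup fgmulA fg1mul fgmul1 fgVmul fgmulV.

Definition fggen (x : X) : freeGroup := fgred [:: (x, true)].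

End FreeGroup.

Section UniversalProperty.
Variables (X : choiceType) (G : groupType) (g : X -> G).

Definition lval (a : letter X) : G := if a.2 then g a.1 else (g a.1)^-1.

Definition wval (w : seq (letter X)) : G := \prod_(a <- w) lval a.

Lemma lvalV a : lval (linv a) = (lval a)^-1.
Proof. by case: a => x [] //=; rewrite /lval /= invgK. Qed.

Lemma wval_reduce w : wval (reduce w) = wval w.
Proof.
rewrite /wval; elim: w => //= a w IH; rewrite big_cons -IH.
case: (reduce w) => [|b v] /=; first by rewrite big_cons.
case: eqP => [->|_]; last by rewrite big_cons.
by rewrite big_cons lvalV mulVKg.
Qed.

Definition fglift (u : freeGroup X) : G := wval u.

Lemma fglift_monoid : monoid_morphism fglift.
Proof.
split; first by rewrite /fglift /wval /= big_nil.
by move=> u v; rewrite /fglift /= wval_reduce /wval big_cat.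
Qed.

HB.instance Definition _ :=
  isUMagmaMorphism.Build (freeGroup X) G fglift fglift_monoid.

Lemma fglift_gen x : fglift (fggen x) = g x.
Proof. by rewrite /fglift /wval /= big_seq1. Qed.

Lemma fglift_unique (f : {multiplicative freeGroup X -> G}) :
  (forall x, f (fggen x) = g x) -> f =1 fglift.
Proof.
move=> fg.
have f1 : f 1 = 1 by apply: (@mulgI _ (f 1)); rewrite -gmulfM !mulg1.
have fV u : f u^-1 = (f u)^-1.
  by apply: (@mulgI _ (f u)); rewrite -gmulfM !mulgV f1.
have fl a : f (fgred [:: a]) = lval a.
  case: a => x [] /=; first exact: fg.
  by rewrite /lval /= -fg -fV; congr (f _).
have fw w : f (fgred w) = wval w.
  elim: w => [|a w IH]; first by rewrite /wval big_nil -f1.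
  rewrite /wval big_cons -[X in _ * X]IH -fl -gmulfM; congr (f _).
  apply: (@val_inj _ _ (freeGroup X)).
  by rewrite /= (reduce_id (reduce_reduced w)).
case=> w rw; rewrite -[RHS]fw; congr (f _).
by apply: (@val_inj _ _ (freeGroup X)); rewrite /= reduce_id.
Qed.

End UniversalProperty.

Section Groups.
Variable G : groupType.

Definition subgroup (H : set G) : Prop := group_closed [in H].

Definition normal_subgroup (N : set G) : Prop :=
  subgroup N /\ forall x y, N x -> N (x ^ y).

Definition generated (A : set G) : set G := smallest subgroup A.

Definition normal_closure (A : set G) : set G := smallest normal_subgroup A.

Definition finitely_generated (H : set G) : Prop :=
  exists s : seq G, H = generated [set` s].

End Groups.

(* G = < 'I_n | R >, up to isomorphism. *)
Definition finitely_presented (G : groupType) : Prop :=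
  exists (n : nat) (R : seq (freeGroup 'I_n))
         (f : {multiplicative freeGroup 'I_n -> G}),
    range f = setT /\ f @^-1` [set 1] = normal_closure [set` R].

(* 'I_k stands for {1, ..., k}; the value false stands for 0, true for 1. *)
Definition configuration (k : nat) : Type :=
  {I : {set 'I_k} | I != finset.set0} -> bool.

Definition realizes (G : groupType) (k : nat) (H : 'I_k -> set G)
    (chi : configuration k) : Prop :=
  forall I : {I : {set 'I_k} | I != finset.set0},
    let HI := \bigcap_(i in [set` sval I]) H i in
    if chi I then ~ finitely_generated HI else finitely_generated HI.

Definition realizable (G : groupType) (k : nat) (chi : configuration k) :
    Prop :=
  exists H : 'I_k -> set G, (forall i, subgroup (H i)) /\ realizes H chi.

Definition intersection_saturated (G : groupType) : Prop :=
  forall (k : nat) (chi : configuration k), 0 < k -> realizable G chi.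

(* Main.v *)
From HB Require Import structures.
Require Import Defs.
From mathcomp Require Import all_boot all_order all_algebra generic_quotient.
From mathcomp Require Import boolp classical_sets.
From mathcomp Require Import lra zify.

(** The group is built around a free group [F2] on two letters [a] and [b].

    Upper part.  Every configuration is realizable in a finite power of [F2].
    The seed is the kernel of the exponent sum of [b] on [F2], which is not
    finitely generated although [F2] is.  Let [I] be a nonempty set of
    indices, pick [i0] in [I], and inside [F2^k] keep all of [F2] at the
    coordinate [i0] and only the cyclic group of [b] at the others.  Choose one
    hyperplane per index of [I]: for [i != i0], the coordinate [i] is trivial;
    for [i0], the exponent sum at [i0] is the sum of the exponents at the other
    places of [I] ([facet]).  Any proper subfamily of these conditions leaves
    the exponent sum at [i0] free, so the intersection maps onto [F2] with
    kernel in a finitely generated abelian group and is finitely generated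
    ([facets_fg]); all of them together force that exponent sum to vanish, and
    the intersection maps onto the bad kernel ([facets_not_fg]).  So exactly the
    intersection indexed by [I] fails to be finitely generated.  Taking the
    product of these families over the sets [I] where a configuration takes the
    value 1 realizes it ([realizable_power]), because a product of finitely many
    subgroups is finitely generated iff every factor is.

    Lower part.  It remains to find a finitely presented group that contains
    all finite powers of [F2]; realizability passes to overgroups
    ([realizable_embedding]).  Take generators [x false], [x true], [t], [v],
    and impose finitely many commutation relations [relators] which hold when
    [t] and [v] are the standard generators of Thompson's group F, seen as
    homeomorphisms of the line, and [x false], [x true] act at the point 0 only.
    There [v] fixes 0 and agrees with [t] to the right of 1; the relations force
    enough of this to make [v] fix the pair [x] and shift its conjugates by
    [t], [t^2], ... one step to the right.  Hence, from the commutation of [x]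
    with its first shift, [x] commutes with all its shifts ([commute_shift]),
    and the shifts of the free group on [x] give a morphism from [F2^n] for
    every [n] ([spread_morphism]).  It is injective since the presented group
    still acts on [rat * F2] as just described, where distinct shifts multiply
    in distinct fibers ([spread_action]). *)

Set Implicit Arguments.
Unset Strict Implicit.
Unset Printing Implicit Defensive.

Import Order.TTheory GRing.Theory Num.Theory.

Local Open Scope group_scope.
Local Open Scope classical_set_scope.

Local Notation "{ 'hom' G -> H }" := (UMagmaMorphism.type G H)
  (at level 0, G at level 98, H at level 99) : type_scope.
Local Notation F2 := (freeGroup bool).
Local Notation a := (@fggen bool false).
Local Notation b := (@fggen bool true).

(** * Subgroups and finite generation *)

Section Subgroups.
Variable G : groupType.
Implicit Types (H K : set G) (A : set G).

Lemma subgroupP H :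
  subgroup H <-> H 1 /\ (forall x y, H x -> H y -> H (x / y)).
Proof.
split=> -[H1 HB]; split; first by move: H1; rewrite inE.
- by move=> x y /mem_set xH /mem_set yH; move: (HB x y xH yH); rewrite inE.
- exact: mem_set.
by move=> x y; rewrite !inE; apply: HB.
Qed.

Lemma subgroup1 H : subgroup H -> H 1.
Proof. by case/subgroupP. Qed.

Lemma subgroupF H x y : subgroup H -> H x -> H y -> H (x / y).
Proof. by case/subgroupP=> _; apply. Qed.

Lemma subgroupV H x : subgroup H -> H x -> H x^-1.
Proof.
move=> sH Hx; rewrite -[x^-1]div1g.
by apply: subgroupF => //; apply: subgroup1.
Qed.

Lemma subgroupM H x y : subgroup H -> H x -> H y -> H (x * y).
Proof.
move=> sH Hx Hy; rewrite -[y]invgK.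
by apply: subgroupF => //; apply: subgroupV.
Qed.

Lemma subgroupX H x n : subgroup H -> H x -> H (x ^+ n).
Proof.
move=> sH Hx; elim: n => [|n IH]; first by rewrite expg0; apply: subgroup1.
by rewrite expgS; apply: subgroupM.
Qed.

Lemma subgroup_set1 : subgroup [set 1 : G].
Proof. by apply/subgroupP; split=> // x y /= -> ->; rewrite divgg. Qed.

Lemma subgroup_bigcap I (P : set I) (F : I -> set G) :
  (forall i, P i -> subgroup (F i)) -> subgroup (\bigcap_(i in P) F i).
Proof.
move=> sF; apply/subgroupP; split=> [i /sF|x y Fx Fy i Pi].
  exact: subgroup1.
by apply: subgroupF; [apply: sF | apply: Fx | apply: Fy].
Qed.

Lemma subgroupI H K : subgroup H -> subgroup K -> subgroup (H `&` K).
Proof.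
move=> sH sK; apply/subgroupP; split; first by split; apply: subgroup1.
by move=> x y [Hx Kx] [Hy Ky]; split; apply: subgroupF.
Qed.

Lemma subgroup_generated A : subgroup (generated A).
Proof. by apply: subgroup_bigcap => H []. Qed.

Lemma fg_of_incl (s : seq G) H : subgroup H -> [set` s] `<=` H ->
  H `<=` generated [set` s] -> finitely_generated H.
Proof.
move=> sH sub_sH sub_Hs; exists s; apply/seteqP; split=> //.
exact: smallest_sub.
Qed.

Lemma fg_trivial : finitely_generated [set 1 : G].
Proof.
apply: (@fg_of_incl [::] _ subgroup_set1) => // x ->.
exact: subgroup1 (subgroup_generated _).
Qed.

(** A subgroup of a cyclic group is generated by its element of least positive
    exponent. *)
Lemma fg_cyclic (b : G) H : subgroup H ->
  (forall x, H x -> exists n, x = b ^+ n \/ x = b ^- n) ->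
  finitely_generated H.
Proof.
move=> sH Hb.
have [[n [n0 Hn]]|nopos] := pselect (exists n, 0 < n /\ H (b ^+ n)); last first.
  suff -> : H = [set 1] by apply: fg_trivial.
  apply/seteqP; split=> x; last by move->; apply: subgroup1.
  move=> Hx /=; have [[|n] bx] := Hb x Hx.
    by case: bx; rewrite expg0 ?invg1.
  exfalso; apply: nopos; exists n.+1; split=> //.
  by case: bx Hx => -> // /(subgroupV sH); rewrite invgK.
have ex_n : exists n, (0 < n) && `[< H (b ^+ n) >].
  by exists n; rewrite n0; apply/asboolP.
case: (ex_minnP ex_n) => m /andP[m0 /asboolP Hm] min_m.
have genX k : H (b ^+ k) -> generated [set` [:: b ^+ m]] (b ^+ k).
  move=> Hk; have gm : generated [set` [:: b ^+ m]] (b ^+ m).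
    by apply: sub_gen_smallest; rewrite /= inE.
  have sg := subgroup_generated [set` [:: b ^+ m]].
  have dE : b ^+ k = (b ^+ m) ^+ (k %/ m) * b ^+ (k %% m).
    by rewrite -expgnA mulnC -expgnDr -divn_eq.
  have r0 : k %% m = 0.
    apply/eqP; rewrite -leqn0 leqNgt; apply/negP => r_pos.
    have := ltn_pmod k m0; rewrite ltnNge min_m // r_pos; apply/asboolP.
    have -> : b ^+ (k %% m) = ((b ^+ m) ^+ (k %/ m))^-1 * b ^+ k.
      by rewrite dE mulKg.
    by apply: subgroupM => //; apply: subgroupV => //; apply: subgroupX.
  by rewrite dE r0 mulg1; exact: subgroupX sg gm.
apply: (@fg_of_incl [:: b ^+ m]) => // x; first by rewrite /= inE => /eqP ->.
move=> Hx; have [k [xE|xE]] := Hb x Hx.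
  by rewrite xE; apply: genX; rewrite -xE.
rewrite xE; apply: (subgroupV (subgroup_generated _)).
by apply: genX; rewrite -[b ^+ k]invgK -xE; apply: subgroupV.
Qed.

End Subgroups.

Section Morphisms.
Variables (G K : groupType) (f : {hom G -> K}).
Implicit Types (H M : set G) (A : set K).

Lemma subgroup_preimage A : subgroup A -> subgroup (f @^-1` A).
Proof.
move=> sA; apply/subgroupP; split; first by rewrite /= gmulf1; apply: subgroup1.
by move=> x y /= Ax Ay; rewrite gmulfF; apply: subgroupF.
Qed.

Lemma subgroup_image H : subgroup H -> subgroup (f @` H).
Proof.
move=> sH; apply/subgroupP; split.
  by exists 1; [apply: subgroup1 | apply: gmulf1].
move=> _ _ [x Hx <-] [y Hy <-]; exists (x / y); last exact: gmulfF.
exact: subgroupF.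
Qed.

Lemma fg_image H : finitely_generated H -> finitely_generated (f @` H).
Proof.
case=> s ->; apply: (@fg_of_incl _ (map f s)).
- exact/subgroup_image/subgroup_generated.
- by move=> _ /= /mapP[x xs ->]; exists x => //; apply: sub_gen_smallest.
move=> _ [x gx <-].
suff : generated [set` s] `<=` f @^-1` generated [set` map f s] by apply.
apply: smallest_sub; first exact/subgroup_preimage/subgroup_generated.
by move=> y ys; apply: sub_gen_smallest; apply/mapP; exists y.
Qed.

(** Lifts of generators of the image together with generators of the kernel
    generate [M]. *)
Lemma fg_extension M : subgroup M -> finitely_generated (f @` M) ->
  finitely_generated (M `&` [set x | f x = 1]) -> finitely_generated M.
Proof.
move=> sM [s fMs] [r Mr].
have lift y : y \in s -> exists x, M x /\ f x = y.
  by move=> ys; have : (f @` M) y;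
    [rewrite fMs; apply: sub_gen_smallest | case=> x; exists x].
pose g y := xget 1 [set x | M x /\ f x = y].
have gP y : y \in s -> M (g y) /\ f (g y) = y.
  by move=> /lift[x xP]; rewrite /g; case: xgetP => [z -> //|/(_ x)].
pose S := map g s ++ r.
have sS := subgroup_generated [set` S].
have Sin x : x \in S -> generated [set` S] x.
  by move=> xS; exact: (@sub_gen_smallest _ (@subgroup G) [set` S]) xS.
have MrS : M `&` [set x | f x = 1] `<=` generated [set` S].
  rewrite Mr; apply: smallest_sub => // x xr; apply: Sin.
  by rewrite mem_cat (_ : x \in r) ?orbT.
apply: (@fg_of_incl _ S) => // x.
  rewrite /= mem_cat => /orP[/mapP[y ys ->]|xr]; first by have [] := gP y ys.
  suff [//] : (M `&` [set x | f x = 1]) x.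
  by rewrite Mr; apply: sub_gen_smallest.
move=> Mx.
have : (f @` (M `&` generated [set` S])) (f x).
  suff : generated [set` s] `<=` f @` (M `&` generated [set` S]).
    by apply; rewrite -fMs; exists x.
  apply: smallest_sub; first exact/subgroup_image/subgroupI.
  move=> y /= ys; have [Mgy fgy] := gP y ys; exists (g y) => //; split=> //.
  by apply: Sin; rewrite mem_cat map_f.
case=> z [Mz Sz] fzx; rewrite -[x](mulVKg z); apply: (subgroupM sS) => //.
apply: MrS; split=> /=; last by rewrite gmulfM gmulfV fzx mulVg.
by apply: subgroupM => //; apply: subgroupV.
Qed.

Lemma fg_image_inj H : injective f -> subgroup H ->
  finitely_generated (f @` H) -> finitely_generated H.
Proof.
move=> f_inj sH fH; apply: fg_extension => //.
suff -> : H `&` [set x | f x = 1] = [set 1] by apply: fg_trivial.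
apply/seteqP; split=> x /=; first by case=> _ fx1; apply: f_inj; rewrite gmulf1.
by move->; split; [apply: subgroup1 | apply: gmulf1].
Qed.

End Morphisms.

(** Finite generation is intrinsic to a subgroup, and an injective image of an
    intersection is the intersection of the images. *)
Lemma realizable_embedding (E G : groupType) (f : {hom E -> G}) k
    (chi : configuration k) :
  injective f -> realizable E chi -> realizable G chi.
Proof.
move=> f_inj [H [sH rH]]; exists (fun i => f @` H i); split=> [i|].
  exact: subgroup_image.
move=> I; move: (rH I) => /=.
have [i0 I0] : exists i, i \in sval I by apply/finset.set0Pn; apply: (svalP I).
have -> : \bigcap_(i in [set` sval I]) (f @` H i) =
    f @` (\bigcap_(i in [set` sval I]) H i).
  apply/seteqP; split=> [y Hy|_ [x Hx <-] i iI]; last first.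
    by exists x => //; apply: Hx.
  have [x _ fx] := Hy i0 I0; exists x => // i iI.
  by have [z Hz fz] := Hy i iI; rewrite -(f_inj z x) // fx.
case: (chi I) => [nfg fg|fg]; last exact: fg_image.
apply: nfg; apply: fg_image_inj fg => //; exact: subgroup_bigcap.
Qed.

(** * Powers of a group *)

Section Powers.
Variables (T : finType) (G : groupType).
Implicit Types (w : {ffun T -> G}) (M : set {ffun T -> G}).

Definition ffcoord (t : T) w : G := w t.

Lemma coord_morphism t : monoid.monoid_morphism (ffcoord t).
Proof. by split=> [|u v]; rewrite /ffcoord ffunE. Qed.

HB.instance Definition _ t :=
  isUMagmaMorphism.Build {ffun T -> G} G (ffcoord t) (coord_morphism t).

Definition at_coord (t : T) (x : G) : {ffun T -> G} :=
  [ffun u => if u == t then x else 1].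

Lemma at_coordE t x u : at_coord t x u = if u == t then x else 1.
Proof. by rewrite /at_coord ffunE. Qed.

(** Peel off one coordinate after the other with [fg_extension]; the subgroups
    met on the way consist of the elements supported in a list [s]. *)
Lemma fg_coords M : subgroup M ->
  (forall (s : seq T) t, finitely_generated
    (ffcoord t @` (M `&` [set w | forall u, u \notin s -> w u = 1]))) ->
  finitely_generated M.
Proof.
move=> sM fgM.
have sV (s : seq T) :
    subgroup (M `&` [set w | forall u, u \notin s -> w u = 1]).
  apply: subgroupI => //; apply/subgroupP; split=> [u _|x y /= x1 y1 u us].
    by rewrite ffunE.
  by rewrite !ffunE x1 // y1 // divgg.
suff fgV (s : seq T) : uniq s -> finitely_generated
    (M `&` [set w | forall u, u \notin s -> w u = 1]).
  rewrite (_ : M = M `&` [set w | forall u, u \notin enum T -> w u = 1]).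
    exact: fgV (enum_uniq T).
  by apply/seteqP; split=> w; [split=> // u; rewrite mem_enum | case].
elim: s => [_|t s IH]; last rewrite cons_uniq => /andP[ts /IH {}IH].
  rewrite (_ : _ `&` _ = [set 1]); first exact: fg_trivial.
  apply/seteqP; split=> [w [_ w1]|_ ->]; last exact: (subgroup1 (sV [::])).
  by apply/ffunP=> u; rewrite w1 ?ffunE.
apply: (@fg_extension _ _ (ffcoord t)); [exact: sV | exact: fgM |].
rewrite [X in finitely_generated X](_ : _ =
  M `&` [set w | forall u, u \notin s -> w u = 1]) //.
apply/seteqP; split=> w /=.
  move=> [[Mw w1] wt]; split=> // u us.
  by have [->//|ut] := eqVneq u t; apply: w1; rewrite inE negb_or ut.
move=> [Mw w1]; split; last exact: w1.
by split=> // u; rewrite inE negb_or => /andP[_]; apply: w1.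
Qed.

Lemma subgroup_box (F : T -> set G) : (forall t, subgroup (F t)) ->
  subgroup [set w : {ffun T -> G} | forall t, F t (w t)].
Proof.
move=> sF; apply/subgroupP; split=> [t|x y /= Fx Fy t].
  by rewrite ffunE; apply: subgroup1.
by rewrite !ffunE; apply: subgroupF.
Qed.

Lemma fg_box (F : T -> set G) : (forall t, subgroup (F t)) ->
  (forall t, finitely_generated (F t)) ->
  finitely_generated [set w : {ffun T -> G} | forall t, F t (w t)].
Proof.
move=> sF fgF; apply: fg_coords => [|s t]; first exact: subgroup_box.
have [ts|ts] := boolP (t \in s); last first.
  rewrite (_ : _ @` _ = [set 1]); first exact: fg_trivial.
  apply/seteqP; split=> [_ [w [_ w1] <-]|_ ->]; first exact: w1.
  exists 1; last exact: gmulf1.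
  by split=> u /=; rewrite ?ffunE => *; rewrite ?ffunE //; apply: subgroup1.
rewrite (_ : _ @` _ = F t) //; apply/seteqP; split=> [_ [w [Fw _] <-]//|x Fx].
exists (at_coord t x); last by rewrite [LHS]at_coordE eqxx.
split=> u /=; rewrite at_coordE.
  by case: eqP => [->//|_]; apply: subgroup1.
by case: eqP => // -> /negP.
Qed.

Lemma not_fg_box (F : T -> set G) t : (forall t, subgroup (F t)) ->
  ~ finitely_generated (F t) ->
  ~ finitely_generated [set w : {ffun T -> G} | forall t, F t (w t)].
Proof.
move=> sF nfg /(fg_image (ffcoord t)); apply: contra_not nfg.
rewrite (_ : _ @` _ = F t) //; apply/seteqP; split=> [_ [w Fw <-]//|x Fx].
exists (at_coord t x); last by rewrite [LHS]at_coordE eqxx.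
by move=> u /=; rewrite at_coordE; case: eqP => [->//|_]; apply: subgroup1.
Qed.

End Powers.

Lemma bigcap_box (I : Type) (P : set I) (T : finType) (G : groupType)
    (F : I -> T -> set G) :
  \bigcap_(i in P) [set w : {ffun T -> G} | forall t, F i t (w t)] =
  [set w : {ffun T -> G} | forall t, (\bigcap_(i in P) F i t) (w t)].
Proof.
by apply/seteqP; split=> w Fw => [t i Pi|i Pi t]; [apply: Fw | apply: Fw].
Qed.

(** * Groups of bijections *)

Section Bijections.
Variable T : Type.

Record bij := Bij {
  bij_fun :> T -> T;
  bij_inv : T -> T;
  bij_funK : cancel bij_fun bij_inv;
  bij_invK : cancel bij_inv bij_fun }.

HB.instance Definition _ := gen_eqMixin bij.
HB.instance Definition _ := gen_choiceMixin bij.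

Lemma bij_ext (f g : bij) : f =1 g -> f = g.
Proof.
case: f g => [f f' fK f'K] [g g' gK g'K] /= fg.
have {}fg : f = g by apply/funext.
subst g; have f'g' : f' = g' by apply/funext=> x; rewrite -{1}[x]g'K fK.
by subst g'; congr Bij; apply: Prop_irrelevance.
Qed.

Definition bij_one : bij := @Bij idfun idfun (fun=> erefl) (fun=> erefl).

(** Bijections act on the right, so that a word acts letter by letter from its
    left end, and conjugation by [g] carries the support by [g]. *)
Definition bij_mul (f g : bij) : bij :=
  @Bij (g \o f) (bij_inv f \o bij_inv g)
    (can_comp (@bij_funK g) (@bij_funK f))
    (can_comp (@bij_invK f) (@bij_invK g)).

Definition bij_opp (f : bij) : bij := Bij (@bij_invK f) (@bij_funK f).

Lemma bij_mulA : associative bij_mul.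
Proof. by move=> f g h; apply: bij_ext. Qed.
Lemma bij_1mul : left_id bij_one bij_mul.
Proof. by move=> f; apply: bij_ext. Qed.
Lemma bij_mul1 : right_id bij_one bij_mul.
Proof. by move=> f; apply: bij_ext. Qed.
Lemma bij_Vmul : left_inverse bij_one bij_opp bij_mul.
Proof. by move=> f; apply: bij_ext => x /=; apply: bij_invK. Qed.
Lemma bij_mulV : right_inverse bij_one bij_opp bij_mul.
Proof. by move=> f; apply: bij_ext => x /=; apply: bij_funK. Qed.

HB.instance Definition _ :=
  isGroup.Build bij bij_mulA bij_1mul bij_mul1 bij_Vmul bij_mulV.

Lemma bijM (f g : bij) x : (f * g) x = g (f x).
Proof. by []. Qed.

Lemma bijV (f : bij) x : f^-1 x = bij_inv f x.
Proof. by []. Qed.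

End Bijections.

(** * The kernel of the exponent sum on a free group *)

Lemma freeGroup_induction (X : choiceType) (H : set (freeGroup X)) :
  subgroup H -> (forall x, H (fggen x)) -> H = setT.
Proof.
move=> sH Hgen; apply/seteqP; split=> // u _.
suff Hw w : H (fgred w).
  have -> : u = fgred u by apply: val_inj; rewrite /= reduce_id //; case: u.
  exact: Hw.
elim: w => [|[x e] w IH]; first exact: (subgroup1 sH).
have -> : fgred ((x, e) :: w) = fgred [:: (x, e)] * fgred w :> freeGroup X.
  by apply: val_inj; rewrite /= (reduce_id (reduce_reduced w)).
apply: (subgroupM sH) => //.
case: e; first exact: Hgen.
rewrite (_ : fgred _ = (fggen x)^-1); first exact: subgroupV.
exact: val_inj.
Qed.

Section ExponentSum.
Local Open Scope ring_scope.

Definition expsum : F2 -> Algebra.to_multiplicative int :=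
  fglift (fun c : bool => (Posz c : Algebra.to_multiplicative int)).
HB.instance Definition _ := UMagmaMorphism.on expsum.

(** The exponent sum again, typed so that the ring structure of the integers
    applies to its values. *)
Definition expsumz (q : F2) : int := expsum q.

Lemma expsumF (p q : F2) : expsumz (p / q)%g = expsumz p - expsumz q.
Proof. exact: (@gmulfF _ _ expsum p q). Qed.
Lemma expsum1 : expsumz 1%g = 0. Proof. exact: (@gmulf1 _ _ expsum). Qed.
Lemma expsumM (p q : F2) : expsumz (p * q)%g = expsumz p + expsumz q.
Proof. exact: (@gmulfM _ _ expsum p q). Qed.
Lemma expsumV (p : F2) : expsumz p^-1%g = - expsumz p.
Proof. exact: (@gmulfV _ _ expsum p). Qed.
Lemma expsum_gen c : expsumz (fggen c) = Posz c.
Proof. by rewrite /expsumz /expsum fglift_gen. Qed.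

(** A row of lamps indexed by the integers, seen through one lamp at a time:
    a point is a position together with the state of a lamp there. *)
Definition flip_fun (z : int * bool) := (z.1, if z.1 == 0 then ~~ z.2 else z.2).

Lemma flip_funK : involutive flip_fun.
Proof. by case=> x y; rewrite /flip_fun /=; case: eqP; rewrite ?negbK. Qed.

Definition flip : bij (int * bool) := Bij flip_funK flip_funK.

Lemma slideK : cancel (fun z : int * bool => (z.1 + 1, z.2))
  (fun z => (z.1 - 1, z.2)).
Proof. by case=> x y /=; rewrite addrK. Qed.

Lemma slideVK : cancel (fun z : int * bool => (z.1 - 1, z.2))
  (fun z => (z.1 + 1, z.2)).
Proof. by case=> x y /=; rewrite subrK. Qed.

Definition slide : bij (int * bool) := Bij slideK slideVK.

(** The lamplighter action of [F2]: [a] switches the lamp at the origin and [b]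
    moves along the row. *)
Definition lamp : F2 -> bij (int * bool) :=
  fglift (fun c : bool => if c then slide else flip).
HB.instance Definition _ := UMagmaMorphism.on lamp.

Lemma lamp_a : lamp a = flip. Proof. exact: fglift_gen. Qed.
Lemma lamp_b : lamp b = slide. Proof. exact: fglift_gen. Qed.

Lemma lampM p q z : lamp (p * q)%g z = lamp q (lamp p z).
Proof. by rewrite [lamp _]gmulfM. Qed.

Lemma lampVK p z : lamp p^-1%g (lamp p z) = z.
Proof. by rewrite -lampM mulgV [lamp _]gmulf1. Qed.

(** A word of length at most [n] started farther than [n] from the origin never
    meets the lamp switched by [a], so it acts as a translation there. *)
Lemma lamp_far (q : F2) : exists n : nat, forall x y, (n%:Z < `|x|) ->
  lamp q (x, y) = (x + expsumz q, y).
Proof.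
pose P := [set q : F2 | exists n : nat, forall x y, (n%:Z < `|x|) ->
  lamp q (x, y) = (x + expsumz q, y)].
move: q; suff PT : P = setT by move=> q; have : P q by rewrite PT.
apply: freeGroup_induction => [|[]].
- apply/subgroupP; split.
    by exists 0%N => x y _; rewrite expsum1 addr0 [lamp _]gmulf1.
  move=> p q [m Pp] [n Pq].
  exists (m + n + `|expsumz p|%N + `|expsumz q|%N)%N => x y x_far.
  rewrite lampM Pp; last by lia.
  rewrite expsumF -[RHS](lampVK q) Pq; last by lia.
  by congr (lamp _ (_, _)); lia.
- exists 0%N => x y _; by rewrite lamp_b expsum_gen.
exists 0%N => x y x0; rewrite lamp_a expsum_gen addr0 /= /flip_fun /=.
by case: eqP => // x0'; move: x0; rewrite x0'.
Qed.

(** Finitely many elements of the kernel switch lamps in a bounded region only,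
    and so does the subgroup that they generate, whereas conjugates of [a] by
    powers of [b] lie in the kernel and switch lamps arbitrarily far away. *)
Lemma expsum_kernel_not_fg : ~ finitely_generated [set q : F2 | expsumz q = 0].
Proof.
case=> s kerE.
have [n far] : exists n : nat, forall q, q \in s -> forall x y, (n%:Z < `|x|) ->
    lamp q (x, y) = (x + expsumz q, y).
  elim: s {kerE} => [|q s [n IH]]; first by exists 0%N.
  have [m qm] := lamp_far q; exists (m + n)%N => p.
  by rewrite inE => /orP[/eqP ->|ps] x y x_far; [apply: qm | apply: IH]; lia.
pose L := [set q | forall x y, (n%:Z < `|x|) -> lamp q (x, y) = (x, y)].
have sL : subgroup L.
  apply/subgroupP; split=> [x y _|p q Lp Lq x y x_far].
    by rewrite [lamp _]gmulf1.
  by rewrite lampM Lp // -{1}(Lq x y x_far) lampVK.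
have : generated [set` s] `<=` L.
  apply: smallest_sub => // q qs x y x_far; rewrite far //.
  suff -> : expsumz q = 0 by rewrite addr0.
  have : generated [set` s] q by apply: sub_gen_smallest.
  by rewrite -kerE.
rewrite -kerE => ker_L.
have bE m x y : lamp (b ^+ m)%g (x, y) = (x + m%:Z, y).
  elim: m x y => [|m IH] x y; first by rewrite expg0 [lamp _]gmulf1 addr0.
  by rewrite expgSr lampM IH lamp_b /=; congr pair; lia.
have bVE m x y : lamp (b ^- m)%g (x, y) = (x - m%:Z, y).
  by rewrite -[in LHS](subrK m%:Z x) -bE lampVK.
have expE m : expsumz (b ^- m * a * b ^+ m)%g = 0.
  by rewrite !expsumM expsumV expsum_gen; lia.
have /(_ n.+1%:Z false) := ker_L _ (expE n.+1).
rewrite !lampM bVE subrr lamp_a bE /= add0r => toggled.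
by suff /toggled : n%:Z < `|n.+1%:Z| by []; lia.
Qed.

End ExponentSum.

(** * Configurations in powers of the free group *)

Section AlmostZero.
Variables (T : finType) (I : {set T}) (i0 : T).
Hypothesis I0 : i0 \in I.
Local Notation E := {ffun T -> F2}.

Definition bpow (x : F2) := exists n, x = b ^+ n \/ x = b ^- n.

(** The only hyperplane that involves the exponent sum at [i0]; on the others,
    coordinates at further indices of [I] vanish one by one. *)
Definition twisted (w : E) :=
  (expsumz (w i0) = \sum_(j in I | j != i0) expsumz (w j))%R.

(** One hyperplane per index in [I].  They are in general position: any proper
    subfamily has a solution with exponent sum 1 at [i0], but a common solution
    has exponent sum 0 there.  Indices outside [I] get the trivial group, which
    makes every intersection over a set not contained in [I] trivial. *)
Definition facet (i : T) : set E :=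
  if i \notin I then [set 1] else
  [set w : E | (forall j, j != i0 -> bpow (w j)) /\
           if i == i0 then twisted w else w i = 1].

Lemma bpowF x y : bpow x -> bpow y -> bpow (x / y).
Proof.
have pow m n : bpow (b ^+ m * b ^- n).
  have [nm|/ltnW mn] := leqP n m.
    by exists (m - n); left; rewrite expgnFr.
  by exists (n - m); right; rewrite expgnFr // invgF.
have powV m n : bpow (b ^- m * b ^+ n).
  suff -> : b ^- m * b ^+ n = b ^+ n * b ^- m by apply: pow.
  exact/commute_sym/commuteV/commuteX2/commute_refl.
move=> [m [->|->]] [n [->|->]] //; last by rewrite invgK.
  by rewrite invgK; exists (m + n); left; rewrite expgnDr.
exists (n + m); right; by rewrite expgnDr invgM.
Qed.

Lemma twistedF u v : twisted u -> twisted v -> twisted (u / v).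
Proof.
rewrite /twisted => u0 v0; rewrite !ffunE expsumF u0 v0 -sumrB.
by apply: eq_bigr => j _; rewrite !ffunE expsumF.
Qed.

Lemma subgroup_facet i : subgroup (facet i).
Proof.
rewrite /facet; case: ifP => _; first exact: subgroup_set1.
apply/subgroupP; split=> /=.
  split=> [j _|]; first by rewrite ffunE; exists 0; left.
  case: eqP => _; last by rewrite ffunE.
  by rewrite /twisted ffunE expsum1 big1 // => j _; rewrite ffunE expsum1.
move=> u v [bu u0] [bv v0]; split=> [j ji|].
  by rewrite !ffunE; apply: bpowF; [apply: bu | apply: bv].
case: eqP u0 v0 => _; first exact: twistedF.
by move=> u0 v0; rewrite !ffunE u0 v0 divgg.
Qed.

Lemma fg_bpow (M : set F2) : subgroup M -> M `<=` bpow -> finitely_generated M.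
Proof. by move=> sM Mb; exact: (@fg_cyclic _ b M sM Mb). Qed.

(** The coordinate [i0] maps the intersection onto the kernel of the exponent
    sum. *)
Lemma facets_not_fg :
  ~ finitely_generated (\bigcap_(i in [set` I]) facet i).
Proof.
move=> /(fg_image (ffcoord i0)).
suff -> : ffcoord i0 @` (\bigcap_(i in [set` I]) facet i) =
  [set q : F2 | expsumz q = 0%R] by apply: expsum_kernel_not_fg.
apply/seteqP; split=> [_ [w Fw <-] /=|q q0].
  have := Fw i0 I0; rewrite /facet I0 /= eqxx => -[_].
  rewrite /twisted /ffcoord => ->; apply: big1 => j /andP[jI ji].
  have := Fw j jI; rewrite /facet jI /= (negPf ji) => -[_ ->].
  exact: expsum1.
exists (at_coord i0 q); last by rewrite [LHS]at_coordE eqxx.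
have w1 j : j != i0 -> at_coord i0 q j = 1 by rewrite at_coordE => /negPf ->.
move=> i iI; have {}iI : i \in I := iI; rewrite /facet iI /=; split=> [j ji|].
  by rewrite w1 //; exists 0; left.
case: eqP => [_|/eqP]; last exact: w1.
rewrite /twisted at_coordE eqxx [LHS]q0 big1 // => j /andP[_ ji].
by rewrite w1 // expsum1.
Qed.

(** When an index [l] of [I] is missing from [J], the coordinate [l] can balance
    any exponent sum at [i0], so the intersection maps onto [F2]; the kernel of
    this map has all its coordinates in the cyclic group of [b]. *)
Lemma facets_fg (J : {set T}) : J != finset.set0 -> J != I ->
  finitely_generated (\bigcap_(i in [set` J]) facet i).
Proof.
move=> J0 JI; set M := \bigcap_(i in _) _.
have sM : subgroup M by apply: subgroup_bigcap => i _; apply: subgroup_facet.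
have [sJI|/subsetPn[i iJ iI]] := boolP (J \subset I); last first.
  suff -> : M = [set 1] by apply: fg_trivial.
  apply/seteqP; split=> [w /(_ i iJ)|_ ->]; last exact: (subgroup1 sM).
  by rewrite /facet iI.
have [l lI lJ] : exists2 l, l \in I & l \notin J.
  by apply/subsetPn; apply: contra JI => sIJ; rewrite finset.eqEsubset sJI.
apply: (@fg_extension _ _ (ffcoord i0)) => //; last first.
  apply: fg_coords => [|s t].
    apply: subgroupI => //.
    exact: (subgroup_preimage (ffcoord i0) (subgroup_set1 _)).
  set K := _ `&` _; have sK : subgroup K.
    apply: subgroupI; first apply: subgroupI => //.
      exact: (subgroup_preimage (ffcoord i0) (subgroup_set1 _)).
    apply/subgroupP; split=> [u _|x y x1 y1 u us]; first by rewrite ffunE.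
    by rewrite !ffunE x1 // y1 // divgg.
  apply: fg_bpow => [|_ [w [[Mw wi0] _] <-]]; first exact: subgroup_image.
  have [->|ti] := eqVneq t i0; first by exists 0; left.
  have [j jJ] := finset.set0Pn _ J0.
  have := Mw j jJ; rewrite /facet (fintype.subsetP sJI) //= => -[bw _].
  exact: bw.
suff -> : ffcoord i0 @` M = setT.
  suff -> : setT = generated [set` [:: a; b]].
    by exists [:: a; b].
  apply/esym/freeGroup_induction => [|c]; first exact: subgroup_generated.
  by apply: sub_gen_smallest; case: c; rewrite /= !inE eqxx ?orbT.
apply: freeGroup_induction => [|c]; first exact: subgroup_image.
(* For [l = i0] the twisted condition is absent, and no balance is required. *)
pose w : E :=
  [ffun j => if j == i0 then fggen c else if (j == l) && c then b else 1].
exists w; last by rewrite /ffcoord ffunE eqxx.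
move=> i iJ; have {}iJ : i \in J := iJ.
have il : i != l by apply: contraNneq lJ => <-.
rewrite /facet (fintype.subsetP sJI) //=; split=> [j ji|].
  rewrite ffunE (negPf ji); case: ifP => _; last by exists 0; left.
  by exists 1%N; left.
have [ii0|ii0] := eqVneq i i0; last by rewrite ffunE (negPf ii0) (negPf il).
have li0 : l != i0 by rewrite -ii0 eq_sym.
rewrite /twisted ffunE eqxx (bigD1 l) /=; last by rewrite lI.
rewrite ffunE (negPf li0) eqxx /= expsum_gen big1 => [|j /andP[/andP[_ ji] jl]].
  by case: (c); rewrite ?expsum_gen ?expsum1 addr0.
by rewrite ffunE (negPf ji) (negPf jl) expsum1.
Qed.

End AlmostZero.

(** In the box of all sides indexed by the sets [I], the side at [I] is cut out
    by the facets of [I] when the configuration takes the value 1 at [I], and is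
    trivial otherwise.  The intersection over [J] then fails to be finitely
    generated only through its side at [J]. *)
Lemma realizable_power (k : nat) (chi : configuration k) :
  realizable {ffun {set 'I_k} -> {ffun 'I_k -> F2}} chi.
Proof.
pose E := {ffun 'I_k -> F2}.
(* [ch] extends the configuration by 0 at the empty set. *)
pose ch (I : {set 'I_k}) := if insub I is Some I' then chi I' else false.
pose F i (I : {set 'I_k}) : set E :=
  if ch I then
    if [pick i0 in I] is Some i0 then facet I i0 i else [set 1]
  else [set 1].
have sF i I : subgroup (F i I).
  rewrite /F; case: ifP => _; last exact: subgroup_set1.
  by case: pickP => [i0 _|_]; [apply: subgroup_facet | apply: subgroup_set1].
exists (fun i => [set w : {ffun {set 'I_k} -> E} | forall I, F i I (w I)]).
split=> [i|J /=].
  exact: subgroup_box.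
have [i1 i1J] := finset.set0Pn _ (svalP J).
have chJ : ch (sval J) = chi J by rewrite /ch valK.
pose FJ I := \bigcap_(i in [set` sval J]) F i I.
have sFJ I : subgroup (FJ I) by apply: subgroup_bigcap.
rewrite bigcap_box; case: ifP => chiJ.
  apply: (@not_fg_box _ _ FJ (sval J)) => //; rewrite /FJ.
  rewrite /F chJ chiJ; case: pickP => [i0 i0J|/(_ i1)]; last by rewrite i1J.
  exact: facets_not_fg.
apply: (@fg_box _ _ FJ) => // I; rewrite /FJ.
have fg1 : finitely_generated (\bigcap_(i in [set` sval J]) [set (1 : E)]).
  suff -> : \bigcap_(i in [set` sval J]) [set (1 : E)] = [set 1].
    exact: fg_trivial.
  by apply/seteqP; split=> [w /(_ i1 i1J)|w w1 i _].
rewrite /F; case chI: (ch I); last exact: fg1.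
case: pickP => [i0 i0I|_]; last exact: fg1.
apply: facets_fg => //; first exact: (svalP J).
by apply: contraFneq chiJ => JI; rewrite -chJ JI.
Qed.

(** * Quotient groups *)

Section Quotient.
Variables (G : groupType) (N : set G).
Hypothesis normN : normal_subgroup N.
Let sN : subgroup N := normN.1.

Let same_coset (x y : G) := `[< N (x / y) >].

Let same_coset_refl : reflexive same_coset.
Proof. by move=> x; apply/asboolP; rewrite divgg; apply: (subgroup1 sN). Qed.

Let same_coset_sym : symmetric same_coset.
Proof.
by move=> x y; apply/asboolP/asboolP=> /(subgroupV sN); rewrite invgF.
Qed.

Let same_coset_trans : transitive same_coset.
Proof.
move=> y x z /asboolP xy /asboolP yz; apply/asboolP.
by rewrite -(divgKA y); apply: (subgroupM sN).
Qed.

Definition coset_equiv :=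
  EquivRel same_coset same_coset_refl same_coset_sym same_coset_trans.
Definition cosets := {eq_quot coset_equiv}%qT.
HB.instance Definition _ := Choice.on cosets.

Let pi (x : G) : cosets := (\pi_({eq_quot coset_equiv}) x)%qT.

Let pi_eq x y : pi x = pi y <-> N (x / y).
Proof.
split=> [/(@eqquotP _ coset_equiv)/asboolP //|Nxy].
by apply/(@eqquotP _ coset_equiv)/asboolP.
Qed.

Let reprP x : N (x / repr (pi x)).
Proof. by apply/pi_eq; rewrite /pi reprK. Qed.

Definition coset_mul (p q : cosets) : cosets := pi (repr p * repr q).
Definition coset_inv (p : cosets) : cosets := pi (repr p)^-1.

Let piM x y : pi (x * y) = coset_mul (pi x) (pi y).
Proof.
apply/pi_eq; set x' := repr (pi x); set y' := repr (pi y).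
have -> : x * y / (x' * y') = (y / y') ^ x^-1 * (x / x').
  by rewrite conjgE invgK invgM !mulgA mulgVK.
by apply: (subgroupM sN); [apply: normN.2; apply: reprP | apply: reprP].
Qed.

Let piV x : pi x^-1 = coset_inv (pi x).
Proof.
apply/pi_eq; set x' := repr (pi x).
have -> : x^-1 / x'^-1 = (x'/ x) ^ x.
  by rewrite conjgE invgK mulgVK.
by apply: normN.2; rewrite -invgF; apply: (subgroupV sN); apply: reprP.
Qed.

Let piK (p : cosets) : p = pi (repr p). Proof. by rewrite /pi reprK. Qed.

Let coset_mulA : associative coset_mul.
Proof. by move=> p q r; rewrite [p]piK [q]piK [r]piK -!piM mulgA. Qed.
Let coset_1mul : left_id (pi 1) coset_mul.
Proof. by move=> p; rewrite [p]piK -!piM mul1g. Qed.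
Let coset_mul1 : right_id (pi 1) coset_mul.
Proof. by move=> p; rewrite [p]piK -!piM mulg1. Qed.
Let coset_Vmul : left_inverse (pi 1) coset_inv coset_mul.
Proof. by move=> p; rewrite [p]piK -piV -piM mulVg. Qed.
Let coset_mulV : right_inverse (pi 1) coset_inv coset_mul.
Proof. by move=> p; rewrite [p]piK -piV -piM mulgV. Qed.

HB.instance Definition _ := isGroup.Build cosets
  coset_mulA coset_1mul coset_mul1 coset_Vmul coset_mulV.

Let pi_morphism : monoid.monoid_morphism (pi : G -> cosets).
Proof. by split=> // x y; apply: piM. Qed.

HB.instance Definition _ := isUMagmaMorphism.Build G cosets pi pi_morphism.

Lemma quotient_group : exists (Q : groupType) (f : {hom G -> Q}),
  range f = setT /\ f @^-1` [set 1] = N.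
Proof.
exists cosets, pi; split; apply/seteqP; split=> x //=.
- by move=> _; exists (repr x) => //; rewrite -piK.
- by move/pi_eq; rewrite divg1.
by move=> Nx; apply/pi_eq; rewrite divg1.
Qed.

End Quotient.

Lemma normal_closure_normal (G : groupType) (A : set G) :
  normal_subgroup (normal_closure A).
Proof.
split; first by apply: subgroup_bigcap => N [[]].
by move=> x y Ax N [nN AN]; apply: nN.2; apply: Ax.
Qed.

Lemma normal_closure_kernel (G K : groupType) (f : {hom G -> K}) (A : set G) :
  (forall x, A x -> f x = 1) -> normal_closure A `<=` [set x | f x = 1].
Proof.
move=> fA; apply: smallest_sub => //; split=> [|x y /= fx].
  exact: (subgroup_preimage f (subgroup_set1 _)).
by rewrite gmulfJ fx conj1g.
Qed.

(** * Relations that make all shifts of a pair commute *)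

Section Shift.
Variables (G : groupType) (x : bool -> G) (t v : G).

Lemma commuteJ (y z s : G) : commute y z -> commute (y ^ s) (z ^ s).
Proof. by rewrite /commute -!conjMg => ->. Qed.

Lemma conjg_commute (y z : G) : commute z y -> y ^ z = y.
Proof. by move=> zy; apply/conjg_fixP/commgP/commute_sym. Qed.

(** Relations between [x], [t] and [v] that hold when [t] and [v] are the
    generators of Thompson's group F acting on the line and [x c] is supported
    at the point 0: then [v] fixes 0, the translation [t] sends 0 to 1 and then
    2, and [v / t] and [v ^ t] are supported to the left and to the right of 1
    respectively. *)
Definition relators : seq G :=
  [~ v / t, v ^ t] ::
  [seq [~ x c, v] | c : bool] ++
  [seq [~ v / t, x c ^ t] | c : bool] ++
  [seq [~ v / t, x c ^ (t ^+ 2)] | c : bool] ++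
  [seq [~ x c.1, x c.2 ^ t] | c : bool * bool].

Lemma relatorsP : {in relators, forall r, r = 1} <->
  [/\ commute (v / t) (v ^ t), forall c, commute (x c) v,
      forall c, commute (v / t) (x c ^ t),
      forall c, commute (v / t) (x c ^ (t ^+ 2)) &
      forall c d, commute (x c) (x d ^ t)].
Proof.
split=> [rel1|[r1 r2 r3 r4 r5] r].
  have com y z : [~ y, z] \in relators -> commute y z.
    by move=> /rel1 yz; apply/commgP/eqP.
  split=> [|c|c|c|c d]; apply: com; rewrite !(inE, mem_cat).
  - by rewrite eqxx.
  - by rewrite (fintype.image_f (fun c => [~ x c, v])) ?orbT.
  - by rewrite (fintype.image_f (fun c => [~ v / t, x c ^ t])) ?orbT.
  - by rewrite (fintype.image_f (fun c => [~ v / t, x c ^ (t ^+ 2)])) ?orbT.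
  rewrite (fintype.image_f (fun c => [~ x c.1, x c.2 ^ t]) (x := (c, d))) //.
  by rewrite !orbT.
rewrite !(inE, mem_cat) => /orP[/eqP ->|]; first exact/eqP/commgP.
by move=> /or4P[] /fintype.imageP[c _ ->]; apply/eqP/commgP.
Qed.

Hypothesis rel1 : {in relators, forall r, r = 1}.

(** If [v / t] commutes with a shift of [x d], then [v] moves this shift as
    [t] does.  As [v / t] commutes with [v ^ t], conjugation by [v ^ t] carries
    this property from the second shift to the third, and so on.  Since [v]
    also fixes [x c], conjugation by [v] carries the commutation of [x c] with
    one shift to the next one. *)
Lemma commute_shift c d n : commute (x c) (x d ^ (t ^+ n.+1)).
Proof.
have [wv xv wx1 wx2 xx] := relatorsP.1 rel1.
pose y n := x d ^ (t ^+ n).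
have yt m : y m ^ t = y m.+1 by rewrite /y -conjgM -expgSr.
have yv m : commute (v / t) (y m) -> y m ^ v = y m.+1.
  move=> wy; have -> : v = v / t * t by rewrite mulgVK.
  by rewrite conjgM (conjg_commute wy) yt.
have wy m : commute (v / t) (y m.+1) /\ commute (v / t) (y m.+2).
  elim: m => [|m [wy1 wy2]]; first by split; [apply: wx1 | apply: wx2].
  split=> //; rewrite -yt -(yv _ wy1) conjJg yt.
  rewrite -{1}(conjg_commute (commute_sym wv)).
  exact: commuteJ.
elim: n => [|n IH]; first exact: xx.
rewrite -/(y n.+2) -yv; last by case: (wy n).
by rewrite -(conjg_commute (commute_sym (xv c))); apply: commuteJ.
Qed.

Definition copy (n : nat) : freeGroup bool -> G :=
  fglift (fun c => x c ^ (t ^+ n)).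
HB.instance Definition _ n := UMagmaMorphism.on (copy n).

Lemma commute_fglift (X : choiceType) (g h : X -> G) :
  (forall c d, commute (g c) (h d)) ->
  forall p q, commute (fglift g p) (fglift h q).
Proof.
have step (k : X -> G) z : (forall c, commute (k c) z) ->
    forall p, commute (fglift k p) z.
  move=> kz p; rewrite /fglift /wval; apply/commute_sym/commute_prod.
  move=> [c []] _; rewrite /lval /=; first exact: commute_sym.
  exact/commuteV/commute_sym.
move=> gh p q; apply: (step) => c; apply/commute_sym; apply: step => d.
exact: commute_sym.
Qed.

Lemma commute_copies m n p q : m != n -> commute (copy m p) (copy n q).
Proof.
have lt_case i j : i < j -> forall p q, commute (copy i p) (copy j q).
  move=> ij; apply: commute_fglift => c d.
  rewrite -(subnK ij) addnS -addSn expgnDr conjgM; apply: commuteJ.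
  exact: commute_shift.
by rewrite neq_ltn => /orP[|] ij; [|apply/commute_sym]; apply: lt_case.
Qed.

End Shift.

Section Spread.
Variables (T : finType) (G : groupType) (x : bool -> G) (t : G).
Implicit Types w : {ffun T -> freeGroup bool}.

Definition spread w : G := \prod_(i : T) copy x t (enum_rank i) (w i).

Lemma spread_morphism v : {in relators x t v, forall r, r = 1} ->
  monoid.monoid_morphism spread.
Proof.
move=> rel1; split=> [|w w'].
  by rewrite /spread big1 // => i _; rewrite ffunE [LHS]gmulf1.
rewrite /spread; elim: (index_enum T) (index_enum_uniq T) => [|i s IH] /=.
  by rewrite !big_nil mulg1.
move=> /andP[iNs /IH{}IH]; rewrite !big_cons {}IH ffunE [copy _ _ _ _]gmulfM.
rewrite !mulgA; congr (_ * _); rewrite -!mulgA; congr (_ * _).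
rewrite big_seq; apply: commute_prod => j js.
apply: commute_copies rel1 _ _ _ _ _.
apply: contraNneq iNs => /ord_inj/enum_rank_inj ->; exact: js.
Qed.

End Spread.

Lemma map_relators (G K : groupType) (f : {hom G -> K})
    (x : bool -> G) (t v : G) :
  map f (relators x t v) = relators (f \o x) (f t) (f v).
Proof.
rewrite /relators /image_mem map_cons !map_cat -!map_comp.
congr (_ :: _ ++ _ ++ _ ++ _).
- by rewrite gmulfR gmulfF gmulfJ.
- by apply: eq_map => c /=; rewrite gmulfR.
- by apply: eq_map => c /=; rewrite gmulfR gmulfF gmulfJ.
- by apply: eq_map => c /=; rewrite gmulfR gmulfF gmulfJ gmulfXn.
by apply: eq_map => c /=; rewrite gmulfR gmulfJ.
Qed.

Lemma spread_map (T : finType) (G K : groupType) (f : {hom G -> K})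
    (x : bool -> G) (t : G) (w : {ffun T -> freeGroup bool}) :
  f (spread x t w) = spread (f \o x) (f t) w.
Proof.
rewrite /spread gmulf_prod; apply: eq_bigr => i _.
rewrite /copy /fglift /wval gmulf_prod; apply: eq_bigr => -[c e] _.
by rewrite /lval; case: e; rewrite /= ?gmulfV gmulfJ gmulfXn.
Qed.

(** * A faithful action of the shifted copies *)

Section Action.
Local Open Scope ring_scope.
Local Notation W := (bij (rat * F2)).

(** One of the two standard generators of Thompson's group F in its action on
    the line, restricted to the rationals; the other one is [translation]. *)
Definition stretch_fun (x : rat) : rat :=
  if x <= 0 then x else if x <= 1 then 2 * x else x + 1.
Definition unstretch_fun (x : rat) : rat :=
  if x <= 0 then x else if x <= 2 then x / 2 else x - 1.

Lemma stretch_funK : cancel stretch_fun unstretch_fun.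
Proof.
move=> x; rewrite /stretch_fun; do !case: leP => ?;
  by rewrite /unstretch_fun; do !case: leP => ?; lra.
Qed.

Lemma unstretch_funK : cancel unstretch_fun stretch_fun.
Proof.
move=> x; rewrite /unstretch_fun; do !case: leP => ?;
  by rewrite /stretch_fun; do !case: leP => ?; lra.
Qed.

Definition stretch : bij rat := Bij stretch_funK unstretch_funK.
Definition translation : bij rat := Bij (addrK (1 : rat)) (subrK (1 : rat)).

Lemma stretch_le0 x : x <= 0 -> stretch_fun x = x.
Proof. by rewrite /stretch_fun => ->. Qed.

Lemma stretch_ge1 x : 1 <= x -> stretch_fun x = x + 1.
Proof. by move=> x1; rewrite /stretch_fun; do !case: leP => ?; lra. Qed.

Lemma stretch_ge0 x : 0 <= x -> 0 <= stretch_fun x.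
Proof.
move=> x0; rewrite /stretch_fun.
by case: (leP x 0) => ?; [|case: (leP x 1) => ?]; lra.
Qed.

Lemma stretch_le2 x : x <= 1 -> stretch_fun x <= 2.
Proof.
move=> x1; rewrite /stretch_fun.
by case: (leP x 0) => ?; [|case: (leP x 1) => ?]; lra.
Qed.

Section OnBase.
Variable f : bij rat.
Lemma on_baseK : cancel (fun z : rat * F2 => (f z.1, z.2))
  (fun z => (bij_inv f z.1, z.2)).
Proof. by case=> x y /=; rewrite bij_funK. Qed.
Lemma on_baseVK : cancel (fun z : rat * F2 => (bij_inv f z.1, z.2))
  (fun z => (f z.1, z.2)).
Proof. by case=> x y /=; rewrite bij_invK. Qed.
Definition on_base : W := Bij on_baseK on_baseVK.
End OnBase.

Lemma on_base_morphism : monoid.monoid_morphism on_base.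
Proof. by split=> [|f g]; apply: bij_ext => -[]. Qed.
HB.instance Definition _ :=
  isUMagmaMorphism.Build (bij rat) W on_base on_base_morphism.

Definition fiber_mul_fun (i : rat) (q : F2) (z : rat * F2) :=
  (z.1, if z.1 == i then (z.2 * q)%g else z.2).

Lemma fiber_mul_funK i q : cancel (fiber_mul_fun i q) (fiber_mul_fun i q^-1%g).
Proof. by case=> x y; rewrite /fiber_mul_fun /=; case: eqP; rewrite ?mulgK. Qed.

Lemma fiber_mul_funVK i q : cancel (fiber_mul_fun i q^-1%g) (fiber_mul_fun i q).
Proof.
by case=> x y; rewrite /fiber_mul_fun /=; case: eqP; rewrite ?mulgVK.
Qed.

Definition fiber_mul i q : W := Bij (fiber_mul_funK i q) (fiber_mul_funVK i q).

Lemma fiber_mul_morphism i : monoid.monoid_morphism (fiber_mul i).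
Proof.
split=> [|p q]; apply: bij_ext => -[x y]; rewrite ?bijM /= /fiber_mul_fun /=.
  by rewrite mulg1 if_same.
by case: eqP; rewrite ?mulgA.
Qed.
HB.instance Definition _ i :=
  isUMagmaMorphism.Build F2 W (fiber_mul i) (fiber_mul_morphism i).

Lemma fiber_mulJ i q f : (fiber_mul i q ^ on_base f)%g = fiber_mul (f i) q.
Proof.
apply: bij_ext => -[x y].
rewrite conjgE !bijM bijV /= /fiber_mul_fun /= bij_invK.
by rewrite (can2_eq (@bij_invK _ f) (@bij_funK _ f)).
Qed.

Lemma commute_fiber_mul i j p q :
  i != j -> commute (fiber_mul i p) (fiber_mul j q).
Proof.
move=> ij; apply: bij_ext => -[x y]; rewrite !bijM /= /fiber_mul_fun /=.
by have [->|//] := eqVneq x i; rewrite (negPf ij).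
Qed.

Lemma commute_fiber_mul_base i q (f : bij rat) : f i = i ->
  commute (on_base f) (fiber_mul i q).
Proof.
by move=> fi; apply/commute_sym/commgP; rewrite -conjg_fix fiber_mulJ fi.
Qed.

Definition fiber_gen (c : bool) : W := fiber_mul 0 (fggen c).

(** Conjugation moves [fiber_mul i] to the fiber over the image of [i], so all
    relators but the first follow from the values of [stretch] and [translation]
    at 0, 1 and 2.  The first compares two bijections of the base with supports
    on either side of 1. *)
Lemma action_relators :
  {in relators fiber_gen (on_base translation) (on_base stretch),
    forall r, r = 1%g}.
Proof.
have tX n : (on_base translation ^+ n = on_base (translation ^+ n))%g.
  by rewrite gmulfXn.
apply/relatorsP; rewrite -[(_ / _)%g]gmulfF; split=> [|c|c|c|c d].
- rewrite -gmulfJ; apply: gmulf_commute; apply: bij_ext => x.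
  rewrite conjgE !bijM !bijV /=.
  (* Left of 1 only [stretch / translation] moves points, right of 1 only the
     conjugate of [stretch] does, and both half-lines are preserved. *)
  have [x1|/ltW x1] := leP x 1.
    have x2 := stretch_le2 x1.
    rewrite (@stretch_le0 (x - 1)) ?subrK; last by lra.
    by rewrite (@stretch_le0 (stretch_fun x - 1 - 1)); lra.
  have x2 : 0 <= stretch_fun (x - 1) by apply: stretch_ge0; lra.
  by rewrite (@stretch_ge1 x) // (@stretch_ge1 (stretch_fun _ + 1)) ?addrK; lra.
- exact/commute_sym/commute_fiber_mul_base.
- by rewrite fiber_mulJ; apply: commute_fiber_mul_base; rewrite bijM.
- by rewrite tX fiber_mulJ; apply: commute_fiber_mul_base; rewrite bijM.
by rewrite fiber_mulJ; apply: commute_fiber_mul.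
Qed.

Lemma copy_action n q :
  copy fiber_gen (on_base translation) n q = fiber_mul n%:R q.
Proof.
rewrite /copy -(@fglift_unique _ _ _ (fiber_mul n%:R)) // => c.
rewrite -[(_ ^+ n)%g]gmulfXn fiber_mulJ; congr fiber_mul.
elim: n => [|n IH]; first by rewrite expg0.
by rewrite expgSr bijM -IH /= -natr1.
Qed.

(** The fiber over the rank of [i] sees the coordinate [i] and no other, hence
    the element can be read off from its action. *)
Lemma spread_action (T : finType) (w : {ffun T -> F2}) i :
  spread fiber_gen (on_base translation) w ((enum_rank i)%:R, 1%g) =
  ((enum_rank i)%:R, w i).
Proof.
have prodE (s : seq T) x y :
    (\prod_(j <- s) fiber_mul (enum_rank j)%:R (w j))%g (x, y) =
    (x, y * \prod_(j <- s | (enum_rank j)%:R == x) w j)%g.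
  elim: s y => [|j s IH] y; first by rewrite !big_nil mulg1.
  rewrite !big_cons bijM /= /fiber_mul_fun /= IH eq_sym.
  by case: eqP; rewrite ?mulgA.
rewrite /spread; under eq_bigr do rewrite copy_action.
rewrite prodE (big_pred1 i) ?mul1g // => j.
by rewrite eqr_nat; apply/eqP/eqP => [/ord_inj/enum_rank_inj|->].
Qed.

End Action.

(** * The finitely presented group *)

Local Notation x4 := (fun c : bool =>
  fggen (if c then @Ordinal 4 1 isT else @Ordinal 4 0 isT)).
Local Notation t4 := (fggen (@Ordinal 4 2 isT)).
Local Notation v4 := (fggen (@Ordinal 4 3 isT)).

Theorem theorem5p8 :
  exists G : groupType, finitely_presented G /\ intersection_saturated G.
Proof.
pose R := relators x4 t4 v4.
have [G [f [f_onto f_ker]]] := quotient_group (normal_closure_normal [set` R]).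
exists G; split; first by exists 4, R, f.
move=> k chi _.
pose T := ({set 'I_k} * 'I_k)%type.
pose U := {ffun {set 'I_k} -> {ffun 'I_k -> freeGroup bool}}.
pose x := f \o x4; pose t := f t4; pose v := f v4.
have rel1 : {in relators x t v, forall r, r = 1}.
  rewrite -map_relators => _ /mapP[r rR ->].
  suff : (f @^-1` [set 1]) r by [].
  by rewrite f_ker => N [_]; apply.
pose act : {hom freeGroup 'I_4 -> bij (rat * freeGroup bool)} :=
  fglift (fun i : 'I_4 => match val i with
    | 0 => fiber_gen false | 1 => fiber_gen true
    | 2 => on_base translation | _ => on_base stretch end).
pose uncurry (w : U) : {ffun T -> freeGroup bool} := [ffun p => w p.1 p.2].
pose e w := spread x t (uncurry w).
have e_morph : monoid.monoid_morphism e.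
  have [e1 eM] := @spread_morphism T _ x t v rel1.
  split=> [|w w'].
    by rewrite -e1; congr spread; apply/ffunP=> p; rewrite !ffunE.
  by rewrite -eM; congr spread; apply/ffunP=> p; rewrite !ffunE.
pose e_hom := isUMagmaMorphism.Build U G e e_morph.
pose e' : {hom U -> G} := HB.pack e e_hom.
apply: (@realizable_embedding _ _ e') (realizable_power chi).
apply: gmulf_inj => w ew1.
have actx : act \o x4 =1 fiber_gen by case; rewrite /= [LHS]fglift_gen.
have spread1 : spread fiber_gen (on_base translation) (uncurry w) = 1.
  have -> : fiber_gen = act \o x4 by apply/funext => c; rewrite actx.
  have -> : on_base translation = act t4 by rewrite [RHS]fglift_gen.
  rewrite -spread_map.
  apply: (@normal_closure_kernel _ _ act [set` R]) => [r rR|].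
    have : {in map act R, forall r, r = 1}.
      rewrite map_relators (funext actx : act \o x4 = fiber_gen).
      rewrite [act t4]fglift_gen [act v4]fglift_gen; exact: action_relators.
    by apply; apply: map_f.
  by rewrite -f_ker /= spread_map.
apply/ffunP=> I; apply/ffunP=> i; rewrite !ffunE.
have := spread_action (uncurry w) (I, i).
by rewrite spread1 ffunE => -[].
Qed.
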